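(* Let $G_3(z)=\sum_{k=0}^{\infty}\dfrac{z^{3^k}}{1-z^{3^k}}$ and $F_3(z)=\sum_{k=0}^{\infty}\dfrac{z^{3^k}}{1+z^{3^k}}$ for $|z|<1$. Then for every integer $b\ge2$, \[\mu\left(G_3\left(\tfrac1b\right),F_3\left(\tfrac1b\right)\right)\le\tfrac{36}{19}.\] Moreover, if $a/b\in\mathbb{Q}$ with $a,b$ integers, $b\ge2$, $\log|a|=\lambda\log b$ and $0\le\lambda<19/29$, then \[\mu\left(G_3\left(\tfrac ab\right),F_3\left(\tfrac ab\right)\right)\le\frac{36(1-\lambda)}{19-29\lambda}.\]
   Context: For real numbers $\alpha_1,\dots,\alpha_n$, the simultaneous approximation exponent $\mu(\alpha_1,\dots,\alpha_n)$ is the supremum of the real numbers $\mu$ such that the inequality $\max_{1\le i\le n}|\alpha_i-p_i/q|<q^{-\mu}$ has infinitely many solutions in rational numbers $p_i/q$ (with common denominator $q\ge1$). *)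

(* Defs.v *)
From Stdlib Require Import Reals List ZArith.
From Coquelicot Require Import Coquelicot.
Open Scope R_scope.

Definition G3 (z : R) : R :=
  Series (fun k : nat => z ^ (3 ^ k) / (1 - z ^ (3 ^ k))).

Definition F3 (z : R) : R :=
  Series (fun k : nat => z ^ (3 ^ k) / (1 + z ^ (3 ^ k))).

Definition infinite_set {T : Type} (S : T -> Prop) : Prop :=
  ~ exists l : list T, forall x, S x -> In x l.

(* (p_1,...,p_n ; q) with q >= 1 solves
   max_i |alpha_i - p_i/q| < q^(-mu)
   (the max of finitely many reals is < c iff each one is). *)
Definition approx_sol (alpha : list R) (mu : R) (s : list Z * Z) : Prop :=
  let (p, q) := s in
  (1 <= q)%Z /\ length p = length alpha /\
  Forall2 (fun a pi => Rabs (a - IZR pi / IZR q) < Rpower (IZR q) (- mu))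
          alpha p.

Definition sim_approx_exp (alpha : list R) : Rbar :=
  Lub_Rbar (fun mu => infinite_set (approx_sol alpha mu)).

(* Main.v *)
Require Import Defs.
From Stdlib Require Import Reals List ZArith.
From Coquelicot Require Import Coquelicot.
From Stdlib Require Import Lra Lia.
Open Scope R_scope.
Import ListNotations.

(* Since [F3 z = - G3 (-z)], only [G3] and its functional equation
   [G3 z = z / (1 - z) + G3 (z ^ 3)] are needed. Explicit Hermite-Pade forms
   [P0 + P1 G3 + P2 F3 = O(z^N)], whose coefficients have degree at most [d], are
   specialised at [u = z ^ (3 ^ k)]. If [1 - z] divides [P1] and [1 + z] divides [P2],
   these factors clear the denominators of [G3 z - G3 u] and [F3 z - F3 u], so
   multiplying by [b ^ (d 3^k)] gives integer linear forms in [1, G3 z, F3 z] of height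
   [b ^ (d 3^k)] and size [b ^ ((d - N beta) 3^k)], where [|z| = b ^ (- beta)].
   At most two of three independent forms vanish at [(q, p1, p2)], and a
   non-vanishing value is at least [1]; this bounds the approximation from below.
   Five such triples, rescaled by the powers of [3], are dense enough on the
   logarithmic scale to give the exponent [36 beta / (29 beta - 10)] for every
   [beta > 10 / 29]. *)

(** * From independent linear forms to a bound for the exponent *)

Definition det3 (a b c d e f g h i : R) : R :=
  a * (e * i - f * h) - b * (d * i - f * g) + c * (d * h - e * g).

(** [H] and [T] are on a logarithmic scale: height about exp H, value about exp (- T). The constant
    [C] absorbs bounded factors, so that it can stay fixed while the scale grows. *)
Definition linear_form (al be C H T : R) (v : Z * Z * Z) : Prop :=
  let '(x, y, z) := v in
  Rabs (IZR y) <= C * exp H /\ Rabs (IZR z) <= C * exp H /\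
  Rabs (IZR x + IZR y * al + IZR z * be) <= C * exp (- T).

Definition det_vec (u v w : Z * Z * Z) : R :=
  let '(a, b, c) := u in let '(d, e, f) := v in let '(g, h, i) := w in
  det3 (IZR a) (IZR b) (IZR c) (IZR d) (IZR e) (IZR f) (IZR g) (IZR h) (IZR i).

Definition independent_forms (al be C H T : R) : Prop :=
  exists u v w, linear_form al be C H T u /\ linear_form al be C H T v /\
    linear_form al be C H T w /\ det_vec u v w <> 0.

Definition eval_form (v : Z * Z * Z) (q p1 p2 : Z) : Z :=
  let '(x, y, z) := v in (x * q + y * p1 + z * p2)%Z.

Lemma independent_form_nonzero (u v w : Z * Z * Z) (q p1 p2 : Z) :
  q <> 0%Z -> det_vec u v w <> 0 ->
  eval_form u q p1 p2 <> 0%Z \/ eval_form v q p1 p2 <> 0%Z \/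
  eval_form w q p1 p2 <> 0%Z.
Proof.
  destruct u as [[a b] c], v as [[d e] f], w as [[g h] i]; simpl.
  intros Hq Hdet.
  destruct (Z.eq_dec (a * q + b * p1 + c * p2) 0) as [H1|]; [|now left].
  destruct (Z.eq_dec (d * q + e * p1 + f * p2) 0) as [H2|]; [|now right; left].
  destruct (Z.eq_dec (g * q + h * p1 + i * p2) 0) as [H3|]; [|now right; right].
  exfalso.
  apply (f_equal IZR) in H1, H2, H3.
  rewrite !plus_IZR, !mult_IZR in H1, H2, H3.
  assert (Hq' : IZR q <> 0) by now apply not_0_IZR.
  apply Hdet, (Rmult_eq_reg_l (IZR q)); [|assumption].
  unfold det3.
  (* Cramer: eliminating [p1], [p2] from the three vanishing forms. *)
  transitivity ((IZR a * IZR q + IZR b * IZR p1 + IZR c * IZR p2)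
                  * (IZR e * IZR i - IZR f * IZR h)
              - (IZR d * IZR q + IZR e * IZR p1 + IZR f * IZR p2)
                  * (IZR b * IZR i - IZR c * IZR h)
              + (IZR g * IZR q + IZR h * IZR p1 + IZR i * IZR p2)
                  * (IZR b * IZR f - IZR c * IZR e)); [ring|].
  rewrite H1, H2, H3; ring.
Qed.

(** A nonzero integer has absolute value at least 1. The value at [(q, p1, p2)] is [q] times the
    real form at [(1, al, be)], corrected by the two approximation errors weighted by [y] and
    [z]. *)
Lemma linear_form_lower_bound (al be C H T mu : R) (v : Z * Z * Z) (q p1 p2 : Z) :
  0 < C -> (1 <= q)%Z -> linear_form al be C H T v -> eval_form v q p1 p2 <> 0%Z ->
  Rabs (al - IZR p1 / IZR q) < Rpower (IZR q) (- mu) ->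
  Rabs (be - IZR p2 / IZR q) < Rpower (IZR q) (- mu) ->
  1 <= IZR q * (C * exp (- T)) + 2 * (C * exp H) * (IZR q * Rpower (IZR q) (- mu)).
Proof.
  destruct v as [[x y] z]; simpl; intros HC Hq (Hy & Hz & Hl) Hne H1 H2.
  assert (Hq1 : 1 <= IZR q) by now apply IZR_le.
  assert (Hge : 1 <= Rabs (IZR (x * q + y * p1 + z * p2))).
  { rewrite <- abs_IZR; apply IZR_le; lia. }
  eapply Rle_trans; [exact Hge|].
  rewrite !plus_IZR, !mult_IZR.
  replace (IZR x * IZR q + IZR y * IZR p1 + IZR z * IZR p2)
    with (IZR q * (IZR x + IZR y * al + IZR z * be)
          + (- (IZR y * (IZR q * (al - IZR p1 / IZR q)))
             + - (IZR z * (IZR q * (be - IZR p2 / IZR q))))) by (field; lra).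
  eapply Rle_trans; [apply Rabs_triang|].
  eapply Rle_trans; [apply Rplus_le_compat_l, Rabs_triang|].
  rewrite !Rabs_Ropp, !Rabs_mult, !(Rabs_pos_eq (IZR q)) by lra.
  set (r := Rpower (IZR q) (- mu)) in *.
  assert (0 < C * exp H) by (apply Rmult_lt_0_compat; [lra|apply exp_pos]).
  assert (Rabs (IZR y) * (IZR q * Rabs (al - IZR p1 / IZR q)) <= C * exp H * (IZR q * r)).
  { apply Rmult_le_compat; [apply Rabs_pos| |exact Hy|apply Rmult_le_compat_l; lra].
    apply Rmult_le_pos; [lra|apply Rabs_pos]. }
  assert (Rabs (IZR z) * (IZR q * Rabs (be - IZR p2 / IZR q)) <= C * exp H * (IZR q * r)).
  { apply Rmult_le_compat; [apply Rabs_pos| |exact Hz|apply Rmult_le_compat_l; lra].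
    apply Rmult_le_pos; [lra|apply Rabs_pos]. }
  assert (IZR q * Rabs (IZR x + IZR y * al + IZR z * be) <= IZR q * (C * exp (- T)))
    by (apply Rmult_le_compat_l; lra).
  lra.
Qed.

Definition Zinterval (n : Z) : list Z :=
  map (fun i => (Z.of_nat i - n)%Z) (seq 0 (Z.to_nat (2 * n + 1))).

Lemma in_Zinterval (n z : Z) : (Z.abs z <= n)%Z -> In z (Zinterval n).
Proof.
  intros H; apply in_map_iff; exists (Z.to_nat (z + n)); split; [lia|].
  apply in_seq; lia.
Qed.

(** For [mu >= 0] the error is below 1, so a bounded denominator also bounds both numerators, and
    all solutions lie in a finite box. *)
Lemma finite_of_bounded_denominator (al be mu Q : R) :
  0 <= mu ->
  (forall p q, approx_sol (al :: be :: nil) mu (p, q) -> IZR q <= Q) ->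
  ~ infinite_set (approx_sol (al :: be :: nil) mu).
Proof.
  intros Hmu HQ Hinf; apply Hinf.
  set (M := up (Q * (Rabs al + Rabs be + 1))).
  set (I := Zinterval M).
  exists (map (fun t => (fst (fst t) :: snd (fst t) :: nil, snd t))
              (list_prod (list_prod I I) (Zinterval (up Q)))).
  intros [p q] Hs; pose proof (HQ p q Hs) as Hq.
  destruct Hs as (Hq1 & Hlen & Hall).
  destruct p as [|p1 [|p2 [|]]]; try discriminate.
  inversion Hall as [|? ? ? ? H1 Hall']; subst.
  inversion Hall' as [|? ? ? ? H2 _]; subst.
  assert (Hq1' : 1 <= IZR q) by now apply IZR_le.
  assert (Hpow : Rpower (IZR q) (- mu) <= 1).
  { rewrite <- (Rpower_O (IZR q)) by lra. apply Rle_Rpower; lra. }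
  assert (Hnum : forall x r, Rabs (x - IZR r / IZR q) < Rpower (IZR q) (- mu) ->
            Rabs x <= Rabs al + Rabs be -> In r I).
  { intros x r Hr Hx; apply in_Zinterval, le_IZR; rewrite abs_IZR.
    assert (Rabs (IZR r) <= IZR q * (Rabs x + 1)).
    { replace (IZR r) with (IZR q * (x - (x - IZR r / IZR q))) by (field; lra).
      rewrite Rabs_mult, (Rabs_pos_eq (IZR q)) by lra.
      apply Rmult_le_compat_l; [lra|].
      eapply Rle_trans; [apply Rabs_triang|]; rewrite Rabs_Ropp; lra. }
    pose proof (archimed (Q * (Rabs al + Rabs be + 1))) as [HM _]; fold M in HM.
    pose proof (Rabs_pos x).
    assert (IZR q * (Rabs x + 1) <= Q * (Rabs al + Rabs be + 1))
      by (apply Rmult_le_compat; lra).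
    lra. }
  apply in_map_iff; exists ((p1, p2), q); split; [reflexivity|].
  pose proof (Rabs_pos al); pose proof (Rabs_pos be).
  apply in_prod; [apply in_prod|].
  - apply (Hnum al); [assumption|lra].
  - apply (Hnum be); [assumption|lra].
  - apply in_Zinterval, le_IZR; rewrite abs_IZR, Rabs_pos_eq by lra.
    pose proof (archimed Q); lra.
Qed.

(** If [mu > 1 + rho], a solution with large [q] contradicts [linear_form_lower_bound] at the scale
    [T = ln (4 C) + ln q]: both terms on its right-hand side together fall below 1. *)
Lemma sim_approx_exp_le (al be rho C T0 : R) :
  0 <= rho -> 0 < C ->
  (forall T, T0 <= T -> independent_forms al be C (rho * T) T) ->
  Rbar_le (sim_approx_exp (al :: be :: nil)) (Finite (1 + rho)).
Proof.
  intros Hrho HC Hforms; unfold sim_approx_exp.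
  apply (proj2 (Lub_Rbar_correct _)); intros mu Hmu; simpl.
  apply Rnot_lt_le; intros Hlt; revert Hmu.
  set (c := ln (4 * C)).
  (* Beyond the first entry the scale [c + ln q] exceeds [T0]; beyond the second the height term
     drops below 3/4. *)
  set (X := Rmax (T0 - c) ((ln (8 / 3 * C) + rho * c) / (mu - 1 - rho))).
  apply finite_of_bounded_denominator with (Q := exp X); [lra|].
  intros p q (Hq1 & Hlen & Hall).
  destruct p as [|p1 [|p2 [|]]]; try discriminate.
  inversion Hall as [|? ? ? ? H1 Hall']; subst.
  inversion Hall' as [|? ? ? ? H2 _]; subst.
  assert (Hq1' : 1 <= IZR q) by now apply IZR_le.
  set (x := ln (IZR q)).
  assert (Hqx : IZR q = exp x) by (unfold x; rewrite exp_ln; lra).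
  rewrite Hqx; apply Rnot_lt_le; intros Hbig; apply exp_lt_inv in Hbig.
  pose proof (Rmax_l (T0 - c) ((ln (8 / 3 * C) + rho * c) / (mu - 1 - rho))) as HX1.
  pose proof (Rmax_r (T0 - c) ((ln (8 / 3 * C) + rho * c) / (mu - 1 - rho))) as HX2.
  fold X in HX1, HX2.
  (* [T] is chosen so that the form of size [C exp (-T)] contributes [1/4]. *)
  destruct (Hforms (c + x)) as (u & v & w & Hu & Hv & Hw & Hdet); [lra|].
  assert (Hex : exists f, linear_form al be C (rho * (c + x)) (c + x) f /\
                          eval_form f q p1 p2 <> 0%Z).
  { destruct (independent_form_nonzero u v w q p1 p2) as [|[|]];
      [lia|assumption|exists u|exists v|exists w]; now split. }
  destruct Hex as (f & Hf & Hne).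
  pose proof (linear_form_lower_bound _ _ _ _ _ mu f q p1 p2 HC Hq1 Hf Hne H1 H2) as Hlow.
  assert (E1 : IZR q * (C * exp (- (c + x))) = 1 / 4).
  { rewrite Hqx, Ropp_plus_distr, exp_plus, !exp_Ropp; unfold c.
    rewrite exp_ln by lra. field; split; [lra|]. pose proof (exp_pos x); lra. }
  (* The factor 8/3 makes this term 3/4 of an exponential, which is below 1 for large [q]; together
     with the 1/4 of [E1] the sum stays below 1. *)
  assert (E2 : 2 * (C * exp (rho * (c + x))) * (IZR q * Rpower (IZR q) (- mu))
               = 3 / 4 * exp (ln (8 / 3 * C) + rho * c - (mu - 1 - rho) * x)).
  { unfold Rpower; fold x. rewrite Hqx.
    replace (ln (8 / 3 * C) + rho * c - (mu - 1 - rho) * x)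
      with (ln (8 / 3 * C) + (rho * (c + x) + (x + - mu * x))) by ring.
    rewrite !exp_plus, exp_ln by lra. field. }
  rewrite E1, E2 in Hlow.
  assert (Hpos : 0 < mu - 1 - rho) by lra.
  assert (Hneg : ln (8 / 3 * C) + rho * c < (mu - 1 - rho) * x).
  { apply (Rmult_lt_reg_r (/ (mu - 1 - rho))); [now apply Rinv_0_lt_compat|].
    replace ((mu - 1 - rho) * x * / (mu - 1 - rho)) with x by (field; lra).
    unfold Rdiv in HX2; lra. }
  pose proof (exp_increasing (ln (8 / 3 * C) + rho * c - (mu - 1 - rho) * x) 0).
  rewrite exp_0 in *. lra.
Qed.

(** * Integer polynomials and the function [G3] *)

Fixpoint peval (p : list Z) (x : R) : R :=
  match p with nil => 0 | c :: p' => IZR c + x * peval p' x end.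

Fixpoint padd (p q : list Z) : list Z :=
  match p, q with
  | nil, _ => q
  | _, nil => p
  | c :: p', d :: q' => (c + d)%Z :: padd p' q'
  end.

Definition pscale (c : Z) (p : list Z) : list Z := map (Z.mul c) p.

Fixpoint pmul (p q : list Z) : list Z :=
  match p with nil => nil | c :: p' => padd (pscale c q) (0%Z :: pmul p' q) end.

Fixpoint preflect (p : list Z) : list Z :=
  match p with nil => nil | c :: p' => c :: pscale (-1) (preflect p') end.

Fixpoint pcube (p : list Z) : list Z :=
  match p with nil => nil | c :: p' => c :: 0%Z :: 0%Z :: pcube p' end.

Fixpoint pnorm (p : list Z) : R :=
  match p with nil => 0 | c :: p' => Rabs (IZR c) + pnorm p' end.

Lemma peval_padd p q x : peval (padd p q) x = peval p x + peval q x.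
Proof.
  revert q; induction p as [|c p IH]; intros [|d q]; simpl; try ring.
  rewrite IH, plus_IZR; ring.
Qed.

Lemma peval_pscale c p x : peval (pscale c p) x = IZR c * peval p x.
Proof.
  unfold pscale; induction p as [|d p IH]; cbn [map peval]; [ring|].
  rewrite IH, mult_IZR; ring.
Qed.

Lemma peval_pmul p q x : peval (pmul p q) x = peval p x * peval q x.
Proof.
  induction p as [|c p IH]; cbn [pmul peval]; [ring|].
  rewrite peval_padd, peval_pscale; cbn [peval]; rewrite IH; ring.
Qed.

Lemma peval_preflect p x : peval (preflect p) x = peval p (- x).
Proof.
  induction p as [|c p IH]; cbn [preflect peval]; [ring|].
  rewrite peval_pscale, IH; ring.
Qed.

Lemma peval_pcube p x : peval (pcube p) x = peval p (x ^ 3).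
Proof. induction p as [|c p IH]; simpl; [ring|]. rewrite IH; simpl; ring. Qed.

Lemma peval_app p q x : peval (p ++ q) x = peval p x + x ^ length p * peval q x.
Proof. induction p as [|c p IH]; simpl; [ring|]. rewrite IH; ring. Qed.

Lemma peval_repeat0 n x : peval (repeat 0%Z n) x = 0.
Proof. induction n as [|n IH]; simpl; [ring|]. rewrite IH; ring. Qed.

Lemma peval_geometric n x : (1 - x) * peval (repeat 1%Z n) x = 1 - x ^ n.
Proof.
  induction n as [|n IH]; simpl; [ring|].
  rewrite Rmult_plus_distr_l, (Rmult_comm x), <- Rmult_assoc, IH; ring.
Qed.

Lemma pnorm_pos p : 0 <= pnorm p.
Proof. induction p as [|c p IH]; simpl; [lra|]. pose proof (Rabs_pos (IZR c)); lra. Qed.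

Lemma peval_le_pnorm p x : Rabs x <= 1 -> Rabs (peval p x) <= pnorm p.
Proof.
  intros Hx; induction p as [|c p IH]; simpl; [rewrite Rabs_R0; lra|].
  eapply Rle_trans; [apply Rabs_triang|].
  rewrite Rabs_mult; apply Rplus_le_compat_l.
  rewrite <- (Rmult_1_l (pnorm p)).
  apply Rmult_le_compat; auto using Rabs_pos.
Qed.

(** Powers of [x] are split off until the constant term is nonzero. Being an integer, it has
    absolute value at least 1 and dominates the rest near 0. *)
Lemma peval_nonzero_near_0 p :
  existsb (fun c => negb (Z.eqb c 0)) p = true ->
  exists d, 0 < d /\ forall x, x <> 0 -> Rabs x < d -> peval p x <> 0.
Proof.
  induction p as [|c p IH]; simpl; [discriminate|].
  destruct (Z.eqb_spec c 0) as [->|Hc]; simpl; intros H.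
  - destruct (IH H) as (d & Hd & Hp); exists d; split; [assumption|].
    intros x Hx Hxd; rewrite Rplus_0_l.
    apply Rmult_integral_contrapositive_currified; auto.
  - pose proof (pnorm_pos p) as Hn.
    (* This radius forces [Rabs x * pnorm p < 1], while the constant term has absolute value at
       least 1. *)
    exists (/ (1 + pnorm p)); split; [apply Rinv_0_lt_compat; lra|].
    intros x _ Hxd H0.
    assert (Hx1 : Rabs x * (1 + pnorm p) < 1).
    { apply (Rmult_lt_compat_r (1 + pnorm p)) in Hxd; [|lra].
      rewrite Rinv_l in Hxd; lra. }
    pose proof (Rabs_pos x) as Hx0.
    assert (Hxle : Rabs x <= 1) by nra.
    assert (Hc1 : 1 <= Rabs (IZR c)) by (rewrite <- abs_IZR; apply IZR_le; lia).
    replace (IZR c) with (- (x * peval p x)) in Hc1 by lra.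
    rewrite Rabs_Ropp, Rabs_mult in Hc1.
    pose proof (peval_le_pnorm p x Hxle).
    assert (Rabs x * Rabs (peval p x) <= Rabs x * pnorm p)
      by (apply Rmult_le_compat_l; lra).
    lra.
Qed.

Definition is_integer (x : R) : Prop := exists n : Z, x = IZR n.

Lemma is_integer_IZR n : is_integer (IZR n).
Proof. now exists n. Qed.

Lemma is_integer_plus x y : is_integer x -> is_integer y -> is_integer (x + y).
Proof. intros [n ->] [m ->]; exists (n + m)%Z; now rewrite plus_IZR. Qed.

Lemma is_integer_minus x y : is_integer x -> is_integer y -> is_integer (x - y).
Proof. intros [n ->] [m ->]; exists (n - m)%Z; now rewrite minus_IZR. Qed.

Lemma is_integer_mult x y : is_integer x -> is_integer y -> is_integer (x * y).
Proof. intros [n ->] [m ->]; exists (n * m)%Z; now rewrite mult_IZR. Qed.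

Lemma is_integer_pow x n : is_integer x -> is_integer (x ^ n).
Proof.
  intros H; induction n as [|n IH]; simpl; [apply (is_integer_IZR 1)|].
  now apply is_integer_mult.
Qed.

(** The factor [c ^ d] homogenises the polynomial: the term of degree i becomes e_i a^i c^(d - i),
    with i at most d. *)
Lemma is_integer_homogeneous p d a c :
  (length p <= S d)%nat -> is_integer a -> is_integer c -> c <> 0 ->
  is_integer (c ^ d * peval p (a / c)).
Proof.
  intros Hl Ha Hc Hc0; revert d Hl.
  induction p as [|e p IH]; intros d Hl; simpl.
  - rewrite Rmult_0_r; apply (is_integer_IZR 0).
  - destruct d as [|d].
    + destruct p; [|simpl in Hl; lia]; simpl.
      replace (1 * (IZR e + a / c * 0)) with (IZR e) by (field; assumption).
      apply is_integer_IZR.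
    + replace (c ^ S d * (IZR e + a / c * peval p (a / c)))
        with (c ^ S d * IZR e + a * (c ^ d * peval p (a / c)))
        by (simpl; field; assumption).
      apply is_integer_plus; apply is_integer_mult;
        auto using is_integer_pow, is_integer_IZR.
      apply IH; simpl in Hl; lia.
Qed.

(** * The series [G3]: convergence, functional equation, partial sums and Taylor polynomials *)

Lemma pow3_ge k : (S k <= 3 ^ k)%nat.
Proof. induction k as [|k IH]; simpl; lia. Qed.

Lemma pow_pow3_S (z : R) k : z ^ (3 ^ S k) = (z ^ (3 ^ k)) ^ 3.
Proof. rewrite <- pow_mult; f_equal; simpl; lia. Qed.

Lemma pow_pow3_opp (z : R) k : (- z) ^ (3 ^ k) = - z ^ (3 ^ k).
Proof.
  induction k as [|k IH]; [simpl; ring|].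
  rewrite !pow_pow3_S, IH; ring.
Qed.

Lemma Rabs_pow_pow3_le z k : Rabs z < 1 -> Rabs (z ^ (3 ^ k)) <= Rabs z ^ S k.
Proof.
  intros Hz; rewrite <- RPow_abs.
  pose proof (pow3_ge k) as Hk.
  replace (3 ^ k)%nat with (S k + (3 ^ k - S k))%nat by lia.
  rewrite pow_add; pose proof (Rabs_pos z).
  rewrite <- (Rmult_1_r (Rabs z ^ S k)) at 2.
  apply Rmult_le_compat_l; [now apply pow_le|].
  rewrite <- (pow1 (3 ^ k - S k)); apply pow_incr; lra.
Qed.

(** Bounds the denominators of the series uniformly in [k], which gives a geometric majorant. *)
Lemma one_minus_pow_pow3 z k : Rabs z < 1 -> 1 - Rabs z <= 1 - z ^ (3 ^ k).
Proof.
  intros Hz; pose proof (Rabs_pow_pow3_le z k Hz) as H.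
  pose proof (Rabs_pos z).
  assert (Rabs z ^ k <= 1) by (rewrite <- (pow1 k); apply pow_incr; lra).
  pose proof (Rle_abs (z ^ (3 ^ k))). simpl in H.
  assert (Rabs z * Rabs z ^ k <= Rabs z * 1) by (apply Rmult_le_compat_l; lra).
  lra.
Qed.

Lemma G3_term_le z k : Rabs z < 1 ->
  Rabs (z ^ (3 ^ k) / (1 - z ^ (3 ^ k))) <= Rabs z / (1 - Rabs z) * Rabs z ^ k.
Proof.
  intros Hz; pose proof (one_minus_pow_pow3 z k Hz) as H1.
  unfold Rdiv; rewrite Rabs_mult, Rabs_inv, (Rabs_pos_eq (1 - _)) by lra.
  replace (Rabs z * / (1 - Rabs z) * Rabs z ^ k)
    with (Rabs z ^ S k * / (1 - Rabs z)) by (simpl; ring).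
  apply Rmult_le_compat;
    [apply Rabs_pos|left; apply Rinv_0_lt_compat; lra|now apply Rabs_pow_pow3_le|].
  apply Rinv_le_contravar; lra.
Qed.

Lemma ex_series_G3 z : Rabs z < 1 ->
  ex_series (fun k => Rabs (z ^ (3 ^ k) / (1 - z ^ (3 ^ k)))).
Proof.
  intros Hz.
  apply (@ex_series_le R_AbsRing R_CompleteNormedModule _
           (fun k => Rabs z / (1 - Rabs z) * Rabs z ^ k)).
  - intros k; unfold norm; simpl; unfold abs; simpl.
    rewrite Rabs_Rabsolu; now apply G3_term_le.
  - apply (ex_series_scal_l (V := R_NormedModule) (Rabs z / (1 - Rabs z))).
    apply ex_series_geom; now rewrite Rabs_Rabsolu.
Qed.

(** All exponents 3^k are odd, so changing the sign of [z] changes the sign of each power. *)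
Lemma F3_G3 z : F3 z = - G3 (- z).
Proof.
  unfold F3, G3; rewrite <- Series_opp; apply Series_ext; intros k.
  rewrite pow_pow3_opp; unfold Rdiv.
  replace (1 - - z ^ (3 ^ k)) with (1 + z ^ (3 ^ k)) by ring; ring.
Qed.

Lemma G3_functional_equation z : Rabs z < 1 -> G3 z = z / (1 - z) + G3 (z ^ 3).
Proof.
  intros Hz; unfold G3.
  rewrite Series_incr_1 by (apply ex_series_Rabs, ex_series_G3, Hz).
  simpl (3 ^ 0)%nat; rewrite pow_1; f_equal.
  apply Series_ext; intros k.
  now rewrite <- pow_mult.
Qed.

Lemma G3_le z : Rabs z <= 1 / 2 -> Rabs (G3 z) <= 4 * Rabs z.
Proof.
  intros Hz; assert (Hz1 : Rabs z < 1) by lra; pose proof (Rabs_pos z).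
  eapply Rle_trans; [apply Series_Rabs, ex_series_G3, Hz1|].
  eapply Rle_trans.
  - apply Series_le with (b := fun k => Rabs z / (1 - Rabs z) * Rabs z ^ k).
    + intros k; split; [apply Rabs_pos|now apply G3_term_le].
    + apply (ex_series_scal_l (V := R_NormedModule) (Rabs z / (1 - Rabs z))).
      apply ex_series_geom; now rewrite Rabs_Rabsolu.
  - rewrite Series_scal_l, Series_geom by now rewrite Rabs_Rabsolu.
    unfold Rdiv; rewrite Rmult_assoc, (Rmult_comm 4).
    apply Rmult_le_compat_l; [assumption|].
    (* The majorant sums to |z| / (1 - |z|)^2, and each inverse is at most 2. *)
    replace 4 with (2 * 2) by ring.
    assert (/ (1 - Rabs z) <= 2).
    { rewrite <- (Rinv_inv 2); apply Rinv_le_contravar; lra. }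
    assert (0 < / (1 - Rabs z)) by (apply Rinv_0_lt_compat; lra).
    apply Rmult_le_compat; lra.
Qed.

Fixpoint G3_sum (z : R) (k : nat) : R :=
  match k with
  | O => 0
  | S k' => G3_sum z k' + z ^ (3 ^ k') / (1 - z ^ (3 ^ k'))
  end.

Lemma Rabs_pow_lt_1 z n : Rabs z < 1 -> (1 <= n)%nat -> Rabs (z ^ n) < 1.
Proof.
  intros Hz Hn; rewrite <- RPow_abs; pose proof (Rabs_pos z).
  apply pow_lt_1_compat; [lra|lia].
Qed.

Lemma G3_iterate z k : Rabs z < 1 -> G3 z = G3_sum z k + G3 (z ^ (3 ^ k)).
Proof.
  intros Hz; induction k as [|k IH]; simpl G3_sum.
  - simpl; rewrite Rmult_1_r; ring.
  - rewrite IH, pow_pow3_S, (G3_functional_equation (z ^ (3 ^ k))); [ring|].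
    apply Rabs_pow_lt_1; [assumption|pose proof (pow3_ge k); lia].
Qed.

(** The j-th term is a^(3^j) / (c^(3^j) - a^(3^j)), and for j < k its denominator divides c^(3^k) -
    a^(3^k). Hence one factor clears the whole partial sum. *)
Lemma is_integer_G3_sum a c k :
  is_integer a -> is_integer c -> c <> 0 -> Rabs (a / c) < 1 ->
  is_integer ((c ^ (3 ^ k) - a ^ (3 ^ k)) * G3_sum (a / c) k).
Proof.
  intros Ha Hc Hc0 Hz; induction k as [|k IH].
  - simpl; rewrite Rmult_0_r; apply (is_integer_IZR 0).
  - rewrite !pow_pow3_S; simpl G3_sum.
    pose proof (one_minus_pow_pow3 (a / c) k Hz) as Hne.
    assert (Hpow : (a / c) ^ (3 ^ k) = a ^ (3 ^ k) / c ^ (3 ^ k))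
      by (unfold Rdiv; now rewrite Rpow_mult_distr, pow_inv).
    rewrite Hpow in *.
    set (x := a ^ (3 ^ k)) in *; set (y := c ^ (3 ^ k)) in *.
    assert (Hy : y <> 0) by now apply pow_nonzero.
    assert (Hyx : y - x <> 0).
    { intros H; replace x with y in Hne by lra.
      unfold Rdiv in Hne; rewrite Rinv_r in Hne by assumption; lra. }
    assert (is_integer x) by now apply is_integer_pow.
    assert (is_integer y) by now apply is_integer_pow.
    (* Uses y^3 - x^3 = (y - x) (y^2 + y x + x^2). *)
    replace ((y ^ 3 - x ^ 3) * (G3_sum (a / c) k + x / y / (1 - x / y)))
      with ((y * y + y * x + x * x) * ((y - x) * G3_sum (a / c) k)
            + x * (y * y + y * x + x * x)) by (field; auto).
    apply is_integer_plus; apply is_integer_mult;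
      auto 6 using is_integer_plus, is_integer_mult.
Qed.

(** The Taylor polynomial of [G3] truncated below degree 3^j: the functional equation adds the
    truncated series of z / (1 - z) to the previous polynomial taken at z^3. *)
Fixpoint G3_taylor (j : nat) : list Z :=
  match j with
  | O => nil
  | S j' => padd (0%Z :: repeat 1%Z (3 ^ S j' - 1)) (pcube (G3_taylor j'))
  end.

(** By the functional equation, the new error is the tail z^(3^(j+1)) / (1 - z) plus the old error
    at z^3, and cubing the argument turns the exponent 3^j into 3^(j+1). *)
Lemma G3_taylor_error j : exists C, 0 <= C /\ forall z, Rabs z <= 1 / 2 ->
  Rabs (G3 z - peval (G3_taylor j) z) <= C * Rabs z ^ (3 ^ j).
Proof.
  induction j as [|j (C & HC & IH)].
  - exists 4; split; [lra|]; intros z Hz; simpl.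
    rewrite Rminus_0_r, Rmult_1_r; now apply G3_le.
  - exists (2 + C); split; [lra|]; intros z Hz.
    pose proof (Rabs_pos z) as Hz0.
    pose proof (Rle_abs z) as Hzz.
    cbn [G3_taylor]; rewrite peval_padd, peval_pcube; cbn [peval].
    set (n := (3 ^ S j - 1)%nat).
    assert (Hn : (3 ^ S j = S n)%nat).
    { unfold n; pose proof (pow3_ge (S j)); lia. }
    assert (Hg : peval (repeat 1%Z n) z = (1 - z ^ n) / (1 - z)).
    { apply (Rmult_eq_reg_l (1 - z)); [|lra].
      rewrite peval_geometric; field; lra. }
    rewrite G3_functional_equation, Hg by lra.
    replace (z / (1 - z) + G3 (z ^ 3)
             - (0 + z * ((1 - z ^ n) / (1 - z)) + peval (G3_taylor j) (z ^ 3)))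
      with (z ^ (3 ^ S j) / (1 - z) + (G3 (z ^ 3) - peval (G3_taylor j) (z ^ 3)))
      by (rewrite Hn; simpl; field; lra).
    eapply Rle_trans; [apply Rabs_triang|].
    rewrite Rmult_plus_distr_r; apply Rplus_le_compat.
    + unfold Rdiv; rewrite Rabs_mult, <- RPow_abs, Rmult_comm.
      apply Rmult_le_compat_r; [now apply pow_le|].
      rewrite Rabs_inv, Rabs_pos_eq by lra.
      rewrite <- (Rinv_inv 2); apply Rinv_le_contravar; lra.
    + assert (Hz3 : Rabs (z ^ 3) <= 1 / 2).
      { rewrite <- RPow_abs; simpl.
        assert (Rabs z * (Rabs z * 1) <= 1 / 2 * 1) by (apply Rmult_le_compat; lra).
        assert (0 <= Rabs z * (Rabs z * 1)) by (apply Rmult_le_pos; lra).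
        assert (Rabs z * (Rabs z * (Rabs z * 1)) <= 1 / 2 * 1)
          by (apply Rmult_le_compat; lra).
        lra. }
      replace (Rabs z ^ (3 ^ S j)) with (Rabs (z ^ 3) ^ (3 ^ j)).
      * now apply IH.
      * rewrite <- RPow_abs, <- pow_mult; f_equal.
Qed.

(** * Specialised Hermite-Pade forms *)

(* [Q] and the sign [s] encode the approximation
   [P0 + (1 - z) Q(z) G3(z) + s (1 + z) Q(-z) G3(-z) = O(z^order)]
   with [deg P0 <= degree]; recall [G3(-z) = - F3(z)]. *)
Record pade := Pade { degree : nat; order : nat; sign : Z; coefs : list Z }.

(** Level 5 of the Taylor polynomial is exact below degree 3^5 = 243, beyond every order used
    later. *)
Definition pade_series (f : pade) : list Z :=
  let h := pmul (pmul [1; -1]%Z (coefs f)) (G3_taylor 5) in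
  padd h (pscale (sign f) (preflect h)).

(** Once Q and the sign are given, P0 is forced: it cancels the terms of degree at most
    [degree f]. *)
Definition pade_const (f : pade) : list Z :=
  pscale (-1) (firstn (S (degree f)) (pade_series f)).

(** The coefficient of F3 with its factor 1 + z removed; the minus sign comes from G3(-z) = -
    F3(z). *)
Definition pade_coef_F3 (f : pade) : list Z :=
  pscale (- sign f) (preflect (coefs f)).

(** Decidable by computation. The length bound leaves room for the factors 1 - z and 1 + z within
    the degree, the bound 3^5 keeps the order within the range of the Taylor polynomial, and the
    last clause says that the coefficients strictly between the degree and the order vanish. *)
Definition pade_valid (f : pade) : Prop :=
  (1 <=? degree f)%nat = true /\ (length (coefs f) <=? degree f)%nat = true /\
  (order f <=? 3 ^ 5)%nat = true /\
  firstn (order f) (pade_series f) =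
    firstn (S (degree f)) (pade_series f) ++ repeat 0%Z (order f - S (degree f)).

(** Expansion along the first row; the factors 1 - z and 1 + z are left out of the second and third
    columns. *)
Definition pade_det (f g h : pade) : list Z :=
  let minor a b c d := padd (pmul a d) (pscale (-1) (pmul b c)) in
  padd (pmul (pade_const f) (minor (coefs g) (pade_coef_F3 g) (coefs h) (pade_coef_F3 h)))
  (padd (pscale (-1) (pmul (coefs f)
           (minor (pade_const g) (pade_coef_F3 g) (pade_const h) (pade_coef_F3 h))))
        (pmul (pade_coef_F3 f)
           (minor (pade_const g) (coefs g) (pade_const h) (coefs h)))).

Definition pade_independent (f g h : pade) : Prop :=
  existsb (fun c => negb (Z.eqb c 0)) (pade_det f g h) = true.

Lemma peval_pade_det f g h x :
  peval (pade_det f g h) x =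
  det3 (peval (pade_const f) x) (peval (coefs f) x) (peval (pade_coef_F3 f) x)
       (peval (pade_const g) x) (peval (coefs g) x) (peval (pade_coef_F3 g) x)
       (peval (pade_const h) x) (peval (coefs h) x) (peval (pade_coef_F3 h) x).
Proof.
  unfold pade_det, det3; cbv zeta.
  rewrite !peval_padd, !peval_pmul, !peval_padd, !peval_pscale, !peval_pmul,
    !peval_padd, !peval_pscale, !peval_pmul; ring.
Qed.

(** Replacing [G3] by its Taylor polynomial leaves u^order times the remaining coefficients; the two
    replacement errors are O(|u|^(3^5)), which is no larger. *)
Lemma pade_error (f : pade) : pade_valid f ->
  exists C, 0 <= C /\ forall u, Rabs u <= 1 / 2 ->
  Rabs (peval (pade_const f) u + (1 - u) * peval (coefs f) u * G3 u
        - (1 + u) * peval (pade_coef_F3 f) u * G3 (- u)) <= C * Rabs u ^ order f.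
Proof.
  intros (_ & _ & Hord & Hser); apply Nat.leb_le in Hord.
  destruct (G3_taylor_error 5) as (C & HC & Herr).
  set (R := skipn (order f) (pade_series f)).
  set (n := pnorm (coefs f)); pose proof (pnorm_pos (coefs f)) as Hn; fold n in Hn.
  set (s := Rabs (IZR (sign f))); pose proof (Rabs_pos (IZR (sign f))) as Hs; fold s in Hs.
  exists (pnorm R + 2 * n * C + 2 * (s * n) * C); split.
  { pose proof (pnorm_pos R).
    assert (0 <= s * n) by now apply Rmult_le_pos.
    assert (0 <= n * C) by now apply Rmult_le_pos.
    assert (0 <= s * n * C) by now apply Rmult_le_pos.
    lra. }
  intros u Hu; pose proof (Rabs_pos u) as Hu0.
  assert (Hmu : Rabs (- u) = Rabs u) by apply Rabs_Ropp.
  (* If the list is shorter than the order, splitting it does not produce the factor [u ^ order f],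
     but then the remainder [R] is empty. *)
  assert (Hlen : (order f <= length (pade_series f))%nat \/ peval R u = 0).
  { destruct (Nat.le_gt_cases (order f) (length (pade_series f))); [now left|right].
    unfold R; rewrite skipn_all2; [reflexivity|lia]. }
  assert (Hsplit : peval (pade_const f) u + peval (pade_series f) u
                   = u ^ order f * peval R u).
  { unfold pade_const; rewrite peval_pscale.
    rewrite <- (firstn_skipn (order f) (pade_series f)) at 2.
    fold R; rewrite peval_app, Hser, peval_app, peval_repeat0, <- Hser.
    destruct Hlen as [Hl|Hl]; [|rewrite Hl; ring].
    rewrite (length_firstn (order f)), (Nat.min_l (order f)) by assumption; ring. }
  assert (Hval : peval (pade_series f) u =
    (1 - u) * peval (coefs f) u * peval (G3_taylor 5) u
    - (1 + u) * peval (pade_coef_F3 f) u * peval (G3_taylor 5) (- u)).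
  { unfold pade_series, pade_coef_F3; cbv zeta.
    rewrite peval_padd, !peval_pscale, !peval_preflect, !peval_pmul, opp_IZR.
    cbn [peval]; ring. }
  replace (peval (pade_const f) u + (1 - u) * peval (coefs f) u * G3 u
           - (1 + u) * peval (pade_coef_F3 f) u * G3 (- u))
    with (u ^ order f * peval R u
          + (1 - u) * peval (coefs f) u * (G3 u - peval (G3_taylor 5) u)
          + - ((1 + u) * peval (pade_coef_F3 f) u
               * (G3 (- u) - peval (G3_taylor 5) (- u))))
    by (rewrite <- Hsplit, Hval; ring).
  assert (Hpow : Rabs u ^ (3 ^ 5) <= Rabs u ^ order f).
  { replace (3 ^ 5)%nat with (order f + (3 ^ 5 - order f))%nat by lia.
    rewrite pow_add; rewrite <- (Rmult_1_r (Rabs u ^ order f)) at 2.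
    apply Rmult_le_compat_l; [now apply pow_le|].
    rewrite <- (pow1 (3 ^ 5 - order f)); apply pow_incr; lra. }
  assert (Hpow0 : 0 <= Rabs u ^ order f) by now apply pow_le.
  assert (HT : forall v, Rabs v = Rabs u ->
            Rabs (G3 v - peval (G3_taylor 5) v) <= C * Rabs u ^ order f).
  { intros v Hv; eapply Rle_trans; [apply Herr; lra|]; rewrite Hv.
    apply Rmult_le_compat_l; assumption. }
  assert (Hside : forall x p v, Rabs x <= 2 -> 0 <= p -> Rabs v <= p ->
            forall w, Rabs w = Rabs u ->
            Rabs (x * v * (G3 w - peval (G3_taylor 5) w))
              <= 2 * p * C * Rabs u ^ order f).
  { intros x p v Hx Hp Hv w Hw; rewrite !Rabs_mult, (Rmult_assoc (2 * p)).
    apply Rmult_le_compat; auto using Rmult_le_pos, Rabs_pos.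
    apply Rmult_le_compat; auto using Rabs_pos. }
  assert (Hb : Rabs (peval (pade_coef_F3 f) u) <= s * n).
  { unfold pade_coef_F3; rewrite peval_pscale, peval_preflect, opp_IZR, Rabs_mult,
      Rabs_Ropp.
    apply Rmult_le_compat_l; [assumption|]; apply peval_le_pnorm; lra. }
  eapply Rle_trans; [apply Rabs_triang|]; rewrite (Rmult_plus_distr_r (pnorm R + 2 * n * C)).
  apply Rplus_le_compat.
  - eapply Rle_trans; [apply Rabs_triang|]; rewrite (Rmult_plus_distr_r (pnorm R)).
    apply Rplus_le_compat.
    + rewrite Rabs_mult, <- RPow_abs, Rmult_comm.
      apply Rmult_le_compat_r; [assumption|apply peval_le_pnorm; lra].
    + apply Hside; auto; [split_Rabs; lra|apply peval_le_pnorm; lra].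
  - rewrite Rabs_Ropp; apply Hside; auto; [split_Rabs; lra|now apply Rmult_le_pos].
Qed.

(** * Integer linear forms at level [k] and their independence *)

Definition pade_vector_spec (z c u : R) (k : nat) (f : pade) (v : Z * Z * Z) : Prop :=
  let '(x, y, w) := v in
  IZR x = c ^ degree f *
    (peval (pade_const f) u - (1 - u) * peval (coefs f) u * G3_sum z k
     + (1 + u) * peval (pade_coef_F3 f) u * G3_sum (- z) k) /\
  IZR y = c ^ degree f * ((1 - u) * peval (coefs f) u) /\
  IZR w = c ^ degree f * ((1 + u) * peval (pade_coef_F3 f) u).

Lemma length_preflect p : length (preflect p) = length p.
Proof. induction p as [|c p IH]; simpl; [|unfold pscale; rewrite length_map]; auto. Qed.

(** With u = e / c one has c (1 - u) = c - e and c (1 + u) = c + e, exactly the integers that clear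
    the partial sums at z and -z. The remaining c^(degree - 1) clears Q(u) and Q(-u). *)
Lemma pade_vector (a b : Z) (k : nat) (f : pade) :
  pade_valid f -> (0 < b)%Z -> Rabs (IZR a / IZR b) < 1 ->
  exists v, pade_vector_spec (IZR a / IZR b) (IZR b ^ (3 ^ k))
              ((IZR a / IZR b) ^ (3 ^ k)) k f v.
Proof.
  intros (Hd & Hlen & _) Hb Hz; apply Nat.leb_le in Hd, Hlen.
  assert (Hb0 : IZR b <> 0) by (apply not_0_IZR; lia).
  pose proof (is_integer_IZR a) as Ia; pose proof (is_integer_IZR b) as Ib.
  set (z := IZR a / IZR b) in *; set (c := IZR b ^ (3 ^ k)); set (u := z ^ (3 ^ k)).
  set (e := IZR a ^ (3 ^ k)).
  assert (Hc0 : c <> 0) by now apply pow_nonzero.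
  assert (Hu : u = e / c).
  { unfold u, e, c, z, Rdiv; now rewrite Rpow_mult_distr, pow_inv. }
  assert (E1 : 1 - u = (c - e) / c) by (rewrite Hu; field; assumption).
  assert (E2 : 1 + u = (c + e) / c) by (rewrite Hu; field; assumption).
  assert (Ie : is_integer e) by now apply is_integer_pow.
  assert (Ic : is_integer c) by now apply is_integer_pow.
  assert (Is1 : is_integer ((c - e) * G3_sum z k)) by now apply is_integer_G3_sum.
  assert (Is2 : is_integer ((c + e) * G3_sum (- z) k)).
  { replace (c + e) with (c - (- IZR a) ^ (3 ^ k))
      by (rewrite pow_pow3_opp; fold e; ring).
    replace (- z) with (- IZR a / IZR b) by (unfold z; field; assumption).
    apply is_integer_G3_sum; auto.
    - rewrite <- opp_IZR; apply is_integer_IZR.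
    - replace (- IZR a / IZR b) with (- z) by (unfold z; field; assumption).
      now rewrite Rabs_Ropp. }
  destruct (degree f) as [|d] eqn:Ed; [lia|].
  assert (I0 : is_integer (c ^ S d * peval (pade_const f) u)).
  { rewrite Hu; apply is_integer_homogeneous; auto.
    unfold pade_const, pscale; rewrite length_map, length_firstn, Ed; lia. }
  assert (I1 : is_integer (c ^ d * peval (coefs f) u)).
  { rewrite Hu; now apply is_integer_homogeneous. }
  assert (I2 : is_integer (c ^ d * peval (pade_coef_F3 f) u)).
  { rewrite Hu; apply is_integer_homogeneous; auto.
    unfold pade_coef_F3, pscale; rewrite length_map, length_preflect; lia. }
  assert (Iy : is_integer (c ^ S d * ((1 - u) * peval (coefs f) u))).
  { replace (c ^ S d * ((1 - u) * peval (coefs f) u))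
      with ((c - e) * (c ^ d * peval (coefs f) u))
      by (rewrite E1; simpl; field; assumption).
    auto using is_integer_mult, is_integer_minus. }
  assert (Iw : is_integer (c ^ S d * ((1 + u) * peval (pade_coef_F3 f) u))).
  { replace (c ^ S d * ((1 + u) * peval (pade_coef_F3 f) u))
      with ((c + e) * (c ^ d * peval (pade_coef_F3 f) u))
      by (rewrite E2; simpl; field; assumption).
    auto using is_integer_mult, is_integer_plus. }
  assert (Ix : is_integer (c ^ S d *
    (peval (pade_const f) u - (1 - u) * peval (coefs f) u * G3_sum z k
     + (1 + u) * peval (pade_coef_F3 f) u * G3_sum (- z) k))).
  { replace (c ^ S d *
      (peval (pade_const f) u - (1 - u) * peval (coefs f) u * G3_sum z k
       + (1 + u) * peval (pade_coef_F3 f) u * G3_sum (- z) k))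
      with (c ^ S d * peval (pade_const f) u
            - (c ^ d * peval (coefs f) u) * ((c - e) * G3_sum z k)
            + (c ^ d * peval (pade_coef_F3 f) u) * ((c + e) * G3_sum (- z) k))
      by (rewrite E1, E2; simpl; field; assumption).
    auto using is_integer_mult, is_integer_plus, is_integer_minus. }
  destruct Ix as [x Ex], Iy as [y Ey], Iw as [w Ew].
  exists (x, y, w); unfold pade_vector_spec; rewrite Ed; auto.
Qed.

(** With X = 3^k L, the coefficients are O(c^degree) = O(exp (X degree)), and the value is
    O(c^degree |u|^order) = O(exp (- X (order be - degree))). *)
Lemma pade_linear_form (f : pade) : pade_valid f ->
  exists C, 0 < C /\
  forall (z c be L : R) (k : nat) (v : Z * Z * Z) (H T : R),
    Rabs z < 1 -> Rabs (z ^ (3 ^ k)) <= 1 / 2 ->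
    c = exp (3 ^ k * L) -> Rabs (z ^ (3 ^ k)) = exp (- (3 ^ k * L * be)) ->
    pade_vector_spec z c (z ^ (3 ^ k)) k f v ->
    3 ^ k * L * INR (degree f) <= H ->
    T <= 3 ^ k * L * (INR (order f) * be - INR (degree f)) ->
    linear_form (G3 z) (F3 z) C H T v.
Proof.
  intros Hf; destruct (pade_error f Hf) as (C0 & HC0 & Herr).
  set (n := pnorm (coefs f)); pose proof (pnorm_pos (coefs f)) as Hn; fold n in Hn.
  set (s := Rabs (IZR (sign f))); pose proof (Rabs_pos (IZR (sign f))) as Hs; fold s in Hs.
  assert (Hsn : 0 <= s * n) by now apply Rmult_le_pos.
  exists (1 + C0 + 2 * n + 2 * (s * n)); split; [lra|].
  intros z c be L k [[x y] w] H T Hz Hu Hc Hab (Ex & Ey & Ew) HH HT.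
  set (u := z ^ (3 ^ k)) in *; set (X := 3 ^ k * L) in *.
  assert (HcH : c ^ degree f = exp (X * INR (degree f))).
  { rewrite Hc, <- Rpower_pow by apply exp_pos.
    unfold Rpower; rewrite ln_exp; f_equal; ring. }
  assert (Hexp : forall t t', t <= t' -> exp t <= exp t').
  { intros t t' [Ht| ->]; [left; now apply exp_increasing|lra]. }
  assert (Hside : forall t p v, Rabs t <= 2 -> 0 <= p -> Rabs v <= p ->
            2 * p <= 1 + C0 + 2 * n + 2 * (s * n) ->
            Rabs (c ^ degree f * (t * v)) <= (1 + C0 + 2 * n + 2 * (s * n)) * exp H).
  { intros t p v Ht Hp Hv Hle.
    rewrite HcH, Rabs_mult, (Rabs_pos_eq (exp _)), Rmult_comm
      by (left; apply exp_pos).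
    apply Rmult_le_compat; [apply Rabs_pos|left; apply exp_pos| |now apply Hexp].
    eapply Rle_trans; [|exact Hle]; rewrite Rabs_mult.
    apply Rmult_le_compat; auto using Rabs_pos. }
  assert (Hb : Rabs (peval (pade_coef_F3 f) u) <= s * n).
  { unfold pade_coef_F3; rewrite peval_pscale, peval_preflect, opp_IZR, Rabs_mult,
      Rabs_Ropp.
    apply Rmult_le_compat_l; [assumption|]; apply peval_le_pnorm.
    rewrite Rabs_Ropp; lra. }
  split; [|split].
  - rewrite Ey; apply Hside with n; [split_Rabs; lra|assumption| |lra].
    apply peval_le_pnorm; lra.
  - rewrite Ew; apply Hside with (s * n); [split_Rabs; lra|assumption|assumption|lra].
  - rewrite Ex, Ey, Ew, F3_G3, (G3_iterate z k) by assumption.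
    rewrite (G3_iterate (- z) k) by (now rewrite Rabs_Ropp).
    rewrite pow_pow3_opp; fold u.
    (* The partial sums cancel and the form at [u] reappears, scaled by [c ^ degree f]. *)
    match goal with |- Rabs ?e <= _ =>
      replace e with (c ^ degree f *
        (peval (pade_const f) u + (1 - u) * peval (coefs f) u * G3 u
         - (1 + u) * peval (pade_coef_F3 f) u * G3 (- u))) by ring end.
    rewrite Rabs_mult, HcH, (Rabs_pos_eq (exp _)) by (left; apply exp_pos).
    eapply Rle_trans; [apply Rmult_le_compat_l, Herr, Hu; left; apply exp_pos|].
    assert (Hup : Rabs u ^ order f = exp (- (X * be) * INR (order f))).
    { rewrite Hab, <- Rpower_pow by apply exp_pos.
      unfold Rpower; rewrite ln_exp; f_equal; ring. }
    rewrite Hup, <- Rmult_assoc, (Rmult_comm _ C0), Rmult_assoc, <- exp_plus.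
    apply Rmult_le_compat; [assumption|left; apply exp_pos|lra|].
    apply Hexp; lra.
Qed.

Lemma linear_form_mono al be C C' H H' T T' v :
  C <= C' -> 0 <= C -> linear_form al be C H T v -> H <= H' -> T' <= T ->
  linear_form al be C' H' T' v.
Proof.
  destruct v as [[x y] w]; intros HC HC0 (H1 & H2 & H3) HH HT.
  assert (Hexp : forall t t', t <= t' -> C * exp t <= C' * exp t').
  { intros t t' Ht; apply Rmult_le_compat; auto; [left; apply exp_pos|].
    destruct Ht as [Ht| ->]; [left; now apply exp_increasing|lra]. }
  split; [|split]; (eapply Rle_trans; [eassumption|apply Hexp; lra]).
Qed.

Lemma independent_forms_mono al be C C' H T :
  C <= C' -> 0 <= C -> independent_forms al be C H T ->
  independent_forms al be C' H T.
Proof.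
  intros HC HC0 (u & v & w & Hu & Hv & Hw & Hdet); exists u, v, w.
  repeat split; try assumption;
    (eapply linear_form_mono; [exact HC|exact HC0|eassumption|lra|lra]).
Qed.

(** The partial sums enter the first column as multiples of the other two, so the determinant of the
    integer vectors is a power of c times (1 - u) (1 + u) times [pade_det] at u. This is nonzero
    once u is small, as u itself is nonzero. *)
Lemma pade_independent_forms (f g h : pade) (a b : Z) (be : R) :
  pade_valid f -> pade_valid g -> pade_valid h -> pade_independent f g h ->
  (1 < b)%Z -> a <> 0%Z -> Rabs (IZR a / IZR b) = exp (- (ln (IZR b) * be)) ->
  0 < be ->
  exists C K, 0 < C /\ forall k H T, (K <= k)%nat ->
    let X := 3 ^ k * ln (IZR b) in
    (forall p, In p [f; g; h] ->
       X * INR (degree p) <= H /\ T <= X * (INR (order p) * be - INR (degree p))) ->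
    independent_forms (G3 (IZR a / IZR b)) (F3 (IZR a / IZR b)) C H T.
Proof.
  intros Hf Hg Hh Hind Hb Ha Hz Hbe.
  assert (Hb1 : 1 < IZR b) by now apply IZR_lt.
  assert (HL : 0 < ln (IZR b)) by (rewrite <- ln_1; apply ln_increasing; lra).
  destruct (pade_linear_form f Hf) as (C1 & HC1 & F1).
  destruct (pade_linear_form g Hg) as (C2 & HC2 & F2).
  destruct (pade_linear_form h Hh) as (C3 & HC3 & F3').
  destruct (peval_nonzero_near_0 _ Hind) as (d & Hd & Hdet).
  set (z := IZR a / IZR b) in *; set (L := ln (IZR b)) in *.
  assert (Hz1 : Rabs z < 1).
  { rewrite Hz, <- exp_0; apply exp_increasing.
    assert (0 < L * be) by now apply Rmult_lt_0_compat. lra. }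
  assert (Hz0 : z <> 0).
  { unfold z, Rdiv; apply Rmult_integral_contrapositive_currified.
    - now apply not_0_IZR.
    - apply Rinv_neq_0_compat; lra. }
  (* From this level on, |u| is below 1/2 for the error estimates and below [d] for the
     determinant. *)
  destruct (pow_lt_1_zero z Hz1 (Rmin (1 / 2) d)) as [K HK].
  { apply Rmin_pos; lra. }
  exists (C1 + C2 + C3), K; split; [lra|].
  intros k H T Hk X Hp.
  assert (Hsmall : Rabs (z ^ (3 ^ k)) < Rmin (1 / 2) d).
  { apply HK; pose proof (pow3_ge k); lia. }
  pose proof (Rmin_l (1 / 2) d); pose proof (Rmin_r (1 / 2) d).
  set (u := z ^ (3 ^ k)) in *.
  assert (Hu0 : u <> 0) by now apply pow_nonzero.
  assert (Hc : IZR b ^ (3 ^ k) = exp (3 ^ k * L)).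
  { rewrite <- Rpower_pow by lra; unfold Rpower; fold L.
    now rewrite pow_INR, (INR_IZR_INZ 3). }
  assert (Hau : Rabs u = exp (- (3 ^ k * L * be))).
  { unfold u; rewrite <- RPow_abs, Hz, <- Rpower_pow by apply exp_pos.
    unfold Rpower; rewrite ln_exp, pow_INR, (INR_IZR_INZ 3); f_equal; simpl IZR; ring. }
  assert (Hb0 : (0 < b)%Z) by lia.
  destruct (pade_vector a b k f Hf Hb0 Hz1) as (v1 & S1).
  destruct (pade_vector a b k g Hg Hb0 Hz1) as (v2 & S2).
  destruct (pade_vector a b k h Hh Hb0 Hz1) as (v3 & S3).
  fold z u in S1, S2, S3.
  exists v1, v2, v3; split; [|split; [|split]].
  - destruct (Hp f) as [Hp1 Hp2]; [simpl; auto|].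
    eapply linear_form_mono with (C := C1); [lra|lra| |apply Rle_refl|apply Rle_refl].
    eapply F1; eauto; fold u; lra.
  - destruct (Hp g) as [Hp1 Hp2]; [simpl; auto|].
    eapply linear_form_mono with (C := C2); [lra|lra| |apply Rle_refl|apply Rle_refl].
    eapply F2; eauto; fold u; lra.
  - destruct (Hp h) as [Hp1 Hp2]; [simpl; auto|].
    eapply linear_form_mono with (C := C3); [lra|lra| |apply Rle_refl|apply Rle_refl].
    eapply F3'; eauto; fold u; lra.
  - assert (Hd' : peval (pade_det f g h) u <> 0) by (apply Hdet; [assumption|lra]).
    rewrite peval_pade_det in Hd'.
    destruct v1 as [[x1 y1] w1], v2 as [[x2 y2] w2], v3 as [[x3 y3] w3].
    cbv beta iota delta [det_vec].
    destruct S1 as (-> & -> & ->), S2 as (-> & -> & ->), S3 as (-> & -> & ->).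
    set (c := IZR b ^ (3 ^ k)) in *.
    assert (Hc0 : c <> 0) by (rewrite Hc; apply Rgt_not_eq, exp_pos).
    assert (H1u : 1 - u <> 0) by (split_Rabs; lra).
    assert (H2u : 1 + u <> 0) by (split_Rabs; lra).
    intros Hv0.
    apply Hd', (Rmult_eq_reg_l (c ^ degree f * c ^ degree g * c ^ degree h
                               * ((1 - u) * (1 + u)))).
    + rewrite Rmult_0_r, <- Hv0; unfold det3; ring.
    + repeat apply Rmult_integral_contrapositive_currified;
        try apply pow_nonzero; assumption.
Qed.

(** * Five triples of forms *)

(* [padeD] has degree [D]; the coefficients come from solving linear systems. The
   exceptional form [2 z^2 + (z^3 - 1) G3(z) + (z^3 + 1) F3(z) = O(z^12)] gives
   [pade9'] and [pade27] by [z -> z^3] and [z -> z^9]. *)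
Definition pade8 := Pade 8 24 1 [1; 1; 0; 1; 1; 0; -3; -3]%Z.
Definition pade9 := Pade 9 27 (-1) (repeat 1%Z 9).
Definition pade9' := Pade 9 36 1 (repeat 1%Z 9).
Definition pade14 := Pade 14 48 1 [1; 1; 0; 4; 4; 0; 1; 1; 0; 0; 0; 0; -7; -7]%Z.
Definition pade15 := Pade 15 45 (-1)
  [-1; -1; -1; -1; -1; -1; 0; 0; 0; 2; 2; 2; 2; 2; 2]%Z.
Definition pade19 := Pade 19 57 (-1)
  [4; 0; 0; 1; 1; 1; 1; 0; 0; -11; -15; -15; -15; -16; -16; -15; -15; -15; -11]%Z.
Definition pade19' := Pade 19 58 1
  [4; 0; 0; 0; -1; -1; 0; 0; 0; 4; 15; 15; 16; 16; 16; 16; 15; 15; 4]%Z.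
Definition pade27 := Pade 27 108 1 (repeat 1%Z 27).
Definition pade29 := Pade 29 87 (-1)
  [52; 52; 0; 1; 1; 0; 1; 1; 0; 14; 14; 0; 1; 1; 0; 1; 1; 0; 14; 14; 0; 1; 1; 0;
   1; 1; 0; -90; -90]%Z.
Definition pade33 := Pade 33 99 (-1)
  [-4; -4; -4; -4; -4; -4; 0; 0; 0; -1; -1; -1; -1; -1; -1; 0; 0; 0; -1; -1; -1;
   -1; -1; -1; 0; 0; 0; 7; 7; 7; 7; 7; 7]%Z.
Definition pade41 := Pade 41 135 (-1)
  [-1; -1; 0; 4; 4; 0; -1; -1; 0; 0; 0; 0; 15; 15; 0; 0; 0; 0; 0; 0; 0; 4; 4; 0; 0;
   0; 0; 2; 2; 0; 0; 0; 0; 2; 2; 0; 0; 0; 0; -26; -26]%Z.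

Ltac check_pade := vm_compute; repeat split.

Lemma pade8_valid : pade_valid pade8. Proof. check_pade. Qed.
Lemma pade9_valid : pade_valid pade9. Proof. check_pade. Qed.
Lemma pade9'_valid : pade_valid pade9'. Proof. check_pade. Qed.
Lemma pade14_valid : pade_valid pade14. Proof. check_pade. Qed.
Lemma pade15_valid : pade_valid pade15. Proof. check_pade. Qed.
Lemma pade19_valid : pade_valid pade19. Proof. check_pade. Qed.
Lemma pade19'_valid : pade_valid pade19'. Proof. check_pade. Qed.
Lemma pade27_valid : pade_valid pade27. Proof. check_pade. Qed.
Lemma pade29_valid : pade_valid pade29. Proof. check_pade. Qed.
Lemma pade33_valid : pade_valid pade33. Proof. check_pade. Qed.
Lemma pade41_valid : pade_valid pade41. Proof. check_pade. Qed.

Lemma independent_8_9_9' : pade_independent pade8 pade9 pade9'.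
Proof. check_pade. Qed.
Lemma independent_27_29_33 : pade_independent pade27 pade29 pade33.
Proof. check_pade. Qed.
Lemma independent_27_33_41 : pade_independent pade27 pade33 pade41.
Proof. check_pade. Qed.
Lemma independent_9'_14_15 : pade_independent pade9' pade14 pade15.
Proof. check_pade. Qed.
Lemma independent_14_19_19' : pade_independent pade14 pade19 pade19'.
Proof. check_pade. Qed.

(** * Covering all large scales by the five triples *)

Lemma pow3_bracket (K : nat) (x : R) : 3 ^ K <= x ->
  exists k, (K <= k)%nat /\ 3 ^ k <= x < 3 ^ S k.
Proof.
  intros Hx; destruct (Pow_x_infinity 3) with (b := x + 1) as [N HN].
  { rewrite Rabs_pos_eq; lra. }
  assert (Hlt : x < 3 ^ (K + N)).
  { specialize (HN (K + N)%nat); rewrite Rabs_pos_eq in HN by (apply pow_le; lra).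
    assert (K + N >= N)%nat by lia. specialize (HN H). lra. }
  clear HN; revert Hlt; induction N as [|N IH]; intros Hlt.
  - rewrite Nat.add_0_r in Hlt; lra.
  - destruct (Rlt_le_dec x (3 ^ (K + N))) as [H|H]; [now apply IH|].
    exists (K + N)%nat; split; [lia|]; split; [assumption|].
    now rewrite <- Nat.add_succ_r.
Qed.

(* If [w Y] was the last scale served by one triple, the next triple, of height
   [exp (D Y)], may be used for all larger [T]. *)
Lemma stage_step (be D w T Y : R) :
  10 / 29 < be -> 0 <= Y ->
  D * (29 * be - 10) <= (7 * be + 10) * w -> w * Y <= T ->
  D * Y <= (7 * be + 10) / (29 * be - 10) * T.
Proof.
  intros Hbe HY HD HT.
  assert (Hpos : 0 < 29 * be - 10) by lra.
  apply (Rmult_le_reg_r (29 * be - 10)); [assumption|].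
  replace ((7 * be + 10) / (29 * be - 10) * T * (29 * be - 10))
    with ((7 * be + 10) * T) by (field; lra).
  assert (D * (29 * be - 10) * Y <= (7 * be + 10) * w * Y)
    by now apply Rmult_le_compat_r.
  assert ((7 * be + 10) * (w * Y) <= (7 * be + 10) * T)
    by (apply Rmult_le_compat_l; lra).
  lra.
Qed.

(** [D] bounds the degrees of a triple and [w] is a lower bound for order * be - degree. Writing
    naturals as [IZR (Z.of_nat _)] lets [simpl] turn them into real literals for [lra]. *)
Lemma stage_size (be D w X H T : R) (p : pade) :
  0 <= X -> D * X <= H -> T <= w * X ->
  IZR (Z.of_nat (degree p)) <= D ->
  w <= IZR (Z.of_nat (order p)) * be - IZR (Z.of_nat (degree p)) ->
  X * INR (degree p) <= H /\ T <= X * (INR (order p) * be - INR (degree p)).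
Proof.
  rewrite !INR_IZR_INZ; intros HX HH HT Hd Hw.
  apply (Rmult_le_compat_r X) in Hd; [|assumption].
  apply (Rmult_le_compat_r X) in Hw; [|assumption].
  split; lra.
Qed.

(** The bound equals 36 be / (29 be - 10). Each large [T] lies in a window from [wA * Y] to
    [3 * (wA * Y)], cut into five stages with one triple each. *)
Lemma exponent_bound (a b : Z) (be : R) :
  (2 <= b)%Z -> a <> 0%Z -> Rabs (IZR a / IZR b) = exp (- (ln (IZR b) * be)) ->
  10 / 29 < be ->
  Rbar_le (sim_approx_exp (G3 (IZR a / IZR b) :: F3 (IZR a / IZR b) :: nil))
          (Finite (1 + (7 * be + 10) / (29 * be - 10))).
Proof.
  intros Hb Ha Hz Hbe.
  assert (Hbe0 : 0 < be) by lra.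
  assert (Hb1 : (1 < b)%Z) by lia.
  assert (HL : 0 < ln (IZR b)).
  { rewrite <- ln_1; apply ln_increasing; [lra|now apply IZR_lt]. }
  destruct (pade_independent_forms pade27 pade29 pade33 a b be) as (C1 & K1 & HC1 & S1);
    auto using pade27_valid, pade29_valid, pade33_valid, independent_27_29_33.
  destruct (pade_independent_forms pade27 pade33 pade41 a b be) as (C2 & K2 & HC2 & S2);
    auto using pade27_valid, pade33_valid, pade41_valid, independent_27_33_41.
  destruct (pade_independent_forms pade9' pade14 pade15 a b be) as (C3 & K3 & HC3 & S3);
    auto using pade9'_valid, pade14_valid, pade15_valid, independent_9'_14_15.
  destruct (pade_independent_forms pade14 pade19 pade19' a b be) as (C4 & K4 & HC4 & S4);
    auto using pade14_valid, pade19_valid, pade19'_valid, independent_14_19_19'.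
  destruct (pade_independent_forms pade8 pade9 pade9' a b be) as (C5 & K5 & HC5 & S5);
    auto using pade8_valid, pade9_valid, pade9'_valid, independent_8_9_9'.
  set (K := (K1 + K2 + K3 + K4 + K5)%nat).
  set (L := ln (IZR b)) in *.
  set (rho := (7 * be + 10) / (29 * be - 10)).
  (* A triple serves the scales [T <= w X], where [w] is the least value of
     [order * be - degree]. With heights measured in units of [Y = 3^k ln b], the
     chain runs through the degrees 33, 41, 45 = 3*15, 57 = 3*19, 81 = 9*9 and
     99 = 3*33, where it closes up at level [k + 1]. *)
  set (wA := 29 * (3 * be - 1)).
  assert (HwA : 0 < wA) by (unfold wA; lra).
  apply sim_approx_exp_le with (C := C1 + C2 + C3 + C4 + C5) (T0 := 3 ^ K * (wA * L)).
  { left; apply Rdiv_lt_0_compat; lra. }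
  { lra. }
  intros T HT0.
  assert (HwL : 0 < wA * L) by now apply Rmult_lt_0_compat.
  destruct (pow3_bracket K (T / (wA * L))) as (k & Hk & Hlo & Hhi).
  { apply Rle_div_r; [exact HwL|]. exact HT0. }
  apply (proj2 (Rle_div_r _ _ _ HwL)) in Hlo.
  apply (proj1 (Rlt_div_l _ _ _ HwL)) in Hhi.
  set (Y := 3 ^ k * L).
  assert (HY : 0 <= Y) by (left; apply Rmult_lt_0_compat; [apply pow_lt|]; lra).
  assert (Hlo' : wA * Y <= T) by (unfold Y; lra).
  assert (Hhi' : T < 3 * (wA * Y)) by (unfold Y; simpl in Hhi; lra).
  assert (Y1 : 3 ^ S k * L = 3 * Y) by (unfold Y; simpl; ring).
  assert (Y2 : 3 ^ S (S k) * L = 9 * Y) by (unfold Y; simpl; ring).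
  pose proof (fun D w => stage_step be D w T Y Hbe HY) as Hstep; fold rho in Hstep.
  (* The least value comes from [pade9'] or [pade15], with the change at be = 2/3. *)
  set (wC := Rmin (36 * be - 9) (45 * be - 15)).
  pose proof (Rmin_l (36 * be - 9) (45 * be - 15)) as HC1'; fold wC in HC1'.
  pose proof (Rmin_r (36 * be - 9) (45 * be - 15)) as HC2'; fold wC in HC2'.
  (* Here [pade14] and [pade19] compete, with the change at be = 5/9. *)
  set (wD := Rmin (48 * be - 14) (57 * be - 19)).
  pose proof (Rmin_l (48 * be - 14) (57 * be - 19)) as HD1'; fold wD in HD1'.
  pose proof (Rmin_r (48 * be - 14) (57 * be - 19)) as HD2'; fold wD in HD2'.
  (* Each test compares [T] with the last scale its triple serves; when it fails, it supplies the
     lower bound on [T] that pays for the height of the next triple. *)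
  destruct (Rle_lt_dec T (33 * (3 * be - 1) * Y)) as [HB|HB].
  { apply independent_forms_mono with (C := C2); [lra|lra|].
    apply (S2 k); [lia|]; fold Y.
    assert (41 * Y <= rho * T).
    { apply (Hstep 41 wA); [|assumption].
      (* The inequality is 609 be^2 - 522 be + 120 >= 0, with negative discriminant and vertex 3/7.
         The squares supplied in the later stages are likewise centred at the vertices of their
         quadratics. *)
      unfold wA; pose proof (pow2_ge_0 (be - 3 / 7)); nra. }
    intros p [<-|[<-|[<-|[]]]];
      apply stage_size with 41 (33 * (3 * be - 1)); simpl; lra. }
  destruct (Rle_lt_dec T (wC * (3 * Y))) as [HC|HC].
  { apply independent_forms_mono with (C := C3); [lra|lra|].
    apply (S3 (S k)); [lia|]; fold L; rewrite Y1.
    assert (45 * Y <= rho * T).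
    { apply (Hstep 45 (33 * (3 * be - 1))); [|lra].
      pose proof (pow2_ge_0 (be - 13 / 33)); nra. }
    intros p [<-|[<-|[<-|[]]]]; apply stage_size with 15 wC; simpl; lra. }
  destruct (Rle_lt_dec T (wD * (3 * Y))) as [HD|HD].
  { apply independent_forms_mono with (C := C4); [lra|lra|].
    apply (S4 (S k)); [lia|]; fold L; rewrite Y1.
    assert (57 * Y <= rho * T).
    { apply (Hstep 57 (3 * wC)); [|lra].
      pose proof (pow2_ge_0 (be - 103 / 315)).
      pose proof (pow2_ge_0 (be - 127 / 252)).
      unfold wC, Rmin; destruct (Rle_dec _ _); nra. }
    intros p [<-|[<-|[<-|[]]]]; apply stage_size with 19 wD; simpl; lra. }
  destruct (Rle_lt_dec T (8 * (3 * be - 1) * (9 * Y))) as [HE|HE].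
  { apply independent_forms_mono with (C := C5); [lra|lra|].
    apply (S5 (S (S k))); [lia|]; fold L; rewrite Y2.
    assert (81 * Y <= rho * T).
    { apply (Hstep 81 (3 * wD)); [|lra].
      pose proof (pow2_ge_0 (be - 173 / 399)).
      pose proof (pow2_ge_0 (be - 401 / 672)).
      unfold wD, Rmin; destruct (Rle_dec _ _); nra. }
    intros p [<-|[<-|[<-|[]]]];
      apply stage_size with 9 (8 * (3 * be - 1)); simpl; lra. }
  (* The triple of degree 33 at level k + 1 serves up to [wA * (3 * Y)], the top of the window. *)
  apply independent_forms_mono with (C := C1); [lra|lra|].
  apply (S1 (S k)); [lia|]; fold L; rewrite Y1.
  assert (99 * Y <= rho * T).
  { apply (Hstep 99 (72 * (3 * be - 1))); [|lra].
    pose proof (pow2_ge_0 (be - 45 / 112)); nra. }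
  intros p [<-|[<-|[<-|[]]]]; apply stage_size with 33 wA; unfold wA; simpl;
    unfold wA in Hhi'; lra.
Qed.

Theorem theorem3 :
  (forall b : Z, (2 <= b)%Z ->
     Rbar_le (sim_approx_exp (G3 (1 / IZR b) :: F3 (1 / IZR b) :: nil))
             (Finite (36 / 19)))
  /\
  (forall (a b : Z) (lambda : R),
     (2 <= b)%Z -> a <> 0%Z ->
     ln (Rabs (IZR a)) = lambda * ln (IZR b) ->
     0 <= lambda -> lambda < 19 / 29 ->
     Rbar_le (sim_approx_exp (G3 (IZR a / IZR b) :: F3 (IZR a / IZR b) :: nil))
             (Finite (36 * (1 - lambda) / (19 - 29 * lambda)))).
Proof.
  assert (Hmain : forall (a b : Z) (lambda : R),
     (2 <= b)%Z -> a <> 0%Z ->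
     ln (Rabs (IZR a)) = lambda * ln (IZR b) -> lambda < 19 / 29 ->
     Rbar_le (sim_approx_exp (G3 (IZR a / IZR b) :: F3 (IZR a / IZR b) :: nil))
             (Finite (36 * (1 - lambda) / (19 - 29 * lambda)))).
  { intros a b lambda Hb Ha Hln Hl.
    (* Here be = 1 - lambda: then |a / b| = b^(- be), and lambda < 19/29 becomes be > 10/29. *)
    replace (36 * (1 - lambda) / (19 - 29 * lambda))
      with (1 + (7 * (1 - lambda) + 10) / (29 * (1 - lambda) - 10)) by (field; lra).
    apply exponent_bound; auto; [|lra].
    assert (Hb0 : 0 < IZR b) by (apply IZR_lt; lia).
    assert (Ha0 : 0 < Rabs (IZR a)) by now apply Rabs_pos_lt, not_0_IZR.
    unfold Rdiv; rewrite Rabs_mult, Rabs_inv, (Rabs_pos_eq (IZR b)) by lra.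
    replace (- (ln (IZR b) * (1 - lambda))) with (ln (Rabs (IZR a)) + - ln (IZR b))
      by (rewrite Hln; ring).
    rewrite exp_plus, exp_Ropp, !exp_ln; auto. }
  split; [|intros; now apply Hmain].
  intros b Hb.
  (* The case a = 1, lambda = 0. *)
  replace (36 / 19) with (36 * (1 - 0) / (19 - 29 * 0)) by field.
  apply Hmain; [assumption|lia| |lra].
  rewrite Rabs_R1, ln_1; ring.
Qed.
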